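(* Let $n\ge 1$, let $\mu_1,\ldots,\mu_n$ be continuous probability measures on $\mathbb{R}^n$ and let $\alpha_1,\ldots,\alpha_n\in[0,1]$. Let $f_1,\ldots,f_n:S^{n-1}\to\mathbb{R}^n$ be functions (not necessarily continuous) such that $\mu_i\big(H^+_{v,\langle v,f_i(v)\rangle}\big)=\alpha_i$ for all $i\in[n]$ and all $v\in S^{n-1}$, and such that each image $\operatorname{Im} f_i$ is bounded. If $\operatorname{Im} f_1,\ldots,\operatorname{Im} f_n$ can be separated by hyperplanes, then there exists an oriented hyperplane $H$ such that $\mu_i(H^+)=\alpha_i$ for all $i\in[n]$.
   Context: A continuous probability measure on $\mathbb{R}^n$ is a Borel probability measure that is absolutely continuous with respect to Lebesgue measure. For $v\in\mathbb{R}^n\setminus\{0\}$ and $\lambda\in\mathbb{R}$, $H_{v,\lambda}=\{x:\langle x,v\rangle=\lambda\}$, $H^+_{v,\lambda}=\{x:\langle x,v\rangle\ge\lambda\}$, $H^-_{v,\lambda}=\{x:\langle x,v\rangle\le\lambda\}$; for an oriented hyperplane $H$, $H^+$ is the closed half-space in the direction of its normal. Sets $S_1,\ldots,S_n\subset\mathbb{R}^n$ can be separated by hyperplanes if for every function $\sigma:[n]\to\{-1,+1\}$ there is a hyperplane $H$ such that for every $i$, $S_i$ is contained in the open half-space $\operatorname{int} H^{\sigma(i)}$ (where $H^{+1}=H^+$, $H^{-1}=H^-$). $[n]=\{1,\ldots,n\}$. *)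

(* Defs.v *)
From HB Require Import structures.
From mathcomp Require Import all_boot all_order all_algebra.
From mathcomp Require Import all_classical all_reals all_analysis.
Set Implicit Arguments. Unset Strict Implicit. Unset Printing Implicit Defensive.
Import Order.TTheory GRing.Theory Num.Theory.
Import numFieldNormedType.Exports.
Local Open Scope classical_set_scope.
Local Open Scope ring_scope.

Definition dotv (R : realType) (n : nat) (x y : 'rV[R]_n) : R :=
  \sum_(i < n) x ord0 i * y ord0 i.

Definition sphere (R : realType) (n : nat) : set 'rV[R]_n :=
  [set v | dotv v v = 1].

Definition hplus (R : realType) (n : nat) (v : 'rV[R]_n) (lam : R) : set 'rV[R]_n :=
  [set x | lam <= dotv x v].
Definition hminus (R : realType) (n : nat) (v : 'rV[R]_n) (lam : R) : set 'rV[R]_n :=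
  [set x | dotv x v <= lam].

Definition borelRn (R : realType) (n : nat) :=
  g_sigma_algebraType (open : set (set 'rV[R]_n)).

Definition box_vol (R : realType) (n : nat) (a b : 'rV[R]_n) : R :=
  \prod_(i < n) (b ord0 i - a ord0 i).

Definition lebesgue_null (R : realType) (n : nat) (A : set 'rV[R]_n) : Prop :=
  forall eps : R, 0 < eps ->
    exists a b : nat -> 'rV[R]_n,
      (forall k (i : 'I_n), a k ord0 i <= b k ord0 i) /\
      A `<=` \bigcup_k [set x | forall i : 'I_n, a k ord0 i <= x ord0 i <= b k ord0 i] /\
      (forall N, \sum_(k < N) box_vol (a k) (b k) <= eps).

(* continuous probability measure: a Borel probability measure on R^n that is
   absolutely continuous w.r.t. Lebesgue measure *)
Definition continuous_prob (R : realType) (n : nat)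
    (mu : probability (borelRn R n) R) : Prop :=
  forall A : set (borelRn R n), measurable A -> lebesgue_null A -> mu A = 0%E.

Definition separable_by_hyperplanes (R : realType) (n : nat)
    (S : 'I_n -> set 'rV[R]_n) : Prop :=
  forall sigma : 'I_n -> bool,
    exists (w : 'rV[R]_n) (lam : R), w != 0 /\
      forall i : 'I_n, forall x, S i x ->
        if sigma i then lam < dotv x w else dotv x w < lam.

(* Main.v *)
Require Import Defs.
From HB Require Import structures.
From mathcomp Require Import all_boot zify.
Set Implicit Arguments. Unset Strict Implicit. Unset Printing Implicit Defensive.

(** For each subset [A] of the indices, separation gives a normal [W A] along
    which the images indexed by [A] lie above the others; for the full set, [W]
    takes a generic value.  Weighting [W A] by a function of [t] that is
    positive only if the coordinates of [t] in [A] are positive and exceed all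
    others yields a continuous nowhere vanishing vector field [w] on the
    simplex.  Label [t] by the index [i] maximising [<v, f_i(v)>] with
    [v = w(t)/|w(t)|].  This is a Sperner labelling, so some point is
    a limit of points of every label.  At the corresponding [v] the sets of
    admissible levels of the measures are intervals, by monotonicity, with
    closed graph, by absolute continuity, and they intersect pairwise; a common
    level is the required hyperplane.

    Sperner's lemma is obtained without triangulations, from Scarf's argument on
    sets dominated with respect to [n] linear orders. *)

(** * Scarf's lemma *)
(** Injectivity makes a maximiser unique. The doors below are described as sets of maximisers, and
    this counts them. *)
Lemma card_argmax (T : finType) (k : T -> nat) (B : {set T}) : injective k ->
  #|[set y in B | [forall z in B, k z <= k y]]| = (B != set0).
Proof.
move=> k_inj; have [->|[y0 y0B]] := set_0Vmem B.
  rewrite eqxx; apply/eqP; rewrite cards_eq0; apply/eqP/setP => y.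
  by rewrite !inE.
have -> : B != set0 by apply/set0Pn; exists y0.
have [y yB ymax] := arg_maxnP k y0B.
apply/eqP/cards1P; exists y; apply/setP => z; rewrite !inE.
apply/andP/eqP => [[zB /forall_inP zmax]|->].
  by apply: k_inj; apply/eqP; rewrite eqn_leq zmax// andbT; exact: ymax.
by split=> //; apply/forall_inP => x xB; exact: ymax.
Qed.

(** * Dominated sets and their one-element extensions *)

Section Dominated.
Variables (n : nat) (T : finType) (key : 'I_n -> T -> nat).
Hypothesis key_inj : forall i, injective (key i).
Implicit Types E F : {set T}.

(** Scarf's condition: no [y] lies strictly above the minimum of [E] in all [n] orders at once. *)
Definition dominated E :=
  [forall y, exists i, forall e in E, key i y <= key i e].

Lemma dominatedP E :
  reflect (forall y, exists i, forall e, e \in E -> key i y <= key i e)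
          (dominated E).
Proof.
apply: (iffP forallP) => h y.
  by have /existsP[i /forall_inP hi] := h y; exists i.
by have [i hi] := h y; apply/existsP; exists i; apply/forall_inP.
Qed.

Lemma dominatedS E F : E \subset F -> dominated F -> dominated E.
Proof.
move=> /subsetP EF /dominatedP dF; apply/dominatedP => y.
by have [i hi] := dF y; exists i => e /EF; exact: hi.
Qed.

(** The elements strictly above the minimum of [E] in every order other than [a]. If [E] is
    dominated, only order [a] can witness this for them. *)
Definition beyond E a :=
  [set y | [forall (i | i != a), exists e in E, key i e < key i y]].

Lemma beyondP E a y :
  reflect (forall i, i != a -> exists2 e, e \in E & key i e < key i y)
          (y \in beyond E a).
Proof.
rewrite inE; apply: (iffP forall_inP) => h i ia.
  by have /exists_inP[e eE he] := h i ia; exists e.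
by have [e eE he] := h i ia; apply/exists_inP; exists e.
Qed.

Lemma beyond_le E a y : dominated E -> y \in beyond E a ->
  forall e, e \in E -> key a y <= key a e.
Proof.
move=> /dominatedP /(_ y)[i hi] /beyondP ya.
have [<-//|ia] := eqVneq i a.
by have [e eE] := ya i ia; rewrite ltnNge hi.
Qed.

Definition top_beyond E a :=
  [set y in beyond E a | [forall z in beyond E a, key a z <= key a y]].

(** Elements of [beyond E a] stay dominated through order [a], because [y] is the largest of them
    there. Any other [z] lies below [E] in some order [i != a], and in that order [y] is above an
    element of [E]. *)
Lemma dominatedU1 E a y : dominated E -> y \in top_beyond E a ->
  dominated (y |: E).
Proof.
move=> dE; rewrite inE => /andP[yB /forall_inP ymax]; apply/dominatedP => z.
have [zB|] := boolP (z \in beyond E a).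
  exists a => e; rewrite !inE => /orP[/eqP->|]; first exact: ymax.
  exact: beyond_le.
rewrite inE negb_forall => /existsP[i]; rewrite negb_imply => /andP[ia].
rewrite negb_exists => /forallP hi; exists i.
have zE e : e \in E -> key i z <= key i e.
  by move=> eE; have := hi e; rewrite eE /= -leqNgt.
move=> e; rewrite !inE => /orP[/eqP->|]; last exact: zE.
have /beyondP/(_ i ia)[e' e'E he'] := yB.
exact: leq_trans (zE _ e'E) (ltnW he').
Qed.

(* With one index more than elements, exactly one element of [E] is minimal for
   two indices [a] and [b]; a new element has to take over one of those. *)
Lemma door_indices E : E != set0 -> #|E|.+1 = n -> dominated E ->
  exists a b, [/\ a != b,
    [disjoint top_beyond E a & top_beyond E b] &
    [set y | (y \notin E) && dominated (y |: E)] =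
      top_beyond E a :|: top_beyond E b].
Proof.
move=> /set0Pn[e0 e0E] cE dE.
pose mn i := [arg min_(e < e0 in E) key i e].
have mnE i : mn i \in E by rewrite /mn; case: arg_minnP.
have mn_min i e : e \in E -> key i (mn i) <= key i e.
  by move=> eE; rewrite /mn; case: arg_minnP => // x _; apply.
have mn_eq i e : e \in E -> (forall e', e' \in E -> key i e <= key i e') ->
    mn i = e.
  move=> eE he; apply: (key_inj (i := i)).
  by apply/eqP; rewrite eqn_leq mn_min// he.
(* Domination of [e] by [E] itself gives an order in which [e] is minimal, so each element is the
   minimum of some order. As [n] orders serve [n - 1] elements, two orders share their minimum. *)
have mn_onto : mn @: [set: 'I_n] = E.
  apply/setP => e; apply/imsetP/idP => [[i _ ->]//|eE].
  have [i hi] := dominatedP _ dE e.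
  by exists i => //; rewrite (mn_eq i e).
have [a [b [ab eab]]] : exists a b, a != b /\ mn a = mn b.
  have /injectivePn[a [b ab eab]] : ~~ injectiveb mn.
    apply/negP => /injectiveP/card_imset h.
    by have := h [set: 'I_n]; rewrite mn_onto cardsT card_ord -cE; lia.
  by exists a, b; split.
have mn_injC c d : c != d -> mn c = mn d -> {in [set~ c] &, injective mn} /\
    mn @: [set~ c] = E.
  move=> cd ecd.
  have h : mn @: [set~ c] = E.
    rewrite -mn_onto; apply/setP => e; apply/imsetP/imsetP => [[i _ ->]|[i _ ->]].
      by exists i.
    have [->|ic] := eqVneq i c; last by exists i; rewrite ?inE.
    by exists d; rewrite ?inE 1?eq_sym.
  split=> //; apply/imset_injP; rewrite h cardsC1 card_ord -cE //.
have half c d y : c != d -> mn c = mn d -> y \in beyond E c -> y \notin E.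
  move=> cd ecd /beyondP yB; apply/negP => yE.
  have [_ h] := mn_injC _ _ cd ecd.
  move: yE; rewrite -h => /imsetP[i]; rewrite !inE => ic yi.
  have [e eE] := yB _ ic.
  by rewrite yi ltnNge mn_min.
(* If [y] takes over order [c], each remaining order [i] is the only one left for [mn i]. Domination
   of [mn i] must therefore happen in order [i], which puts [y] above [mn i] there. *)
have halfE c d y : c != d -> mn c = mn d -> y \notin E -> dominated (y |: E) ->
    (forall e, e \in E -> key c y <= key c e) -> y \in top_beyond E c.
  move=> cd ecd yE /dominatedP dy yc.
  have [inj_c _] := mn_injC _ _ cd ecd.
  rewrite inE; apply/andP; split; last first.
    apply/forall_inP => z /beyondP zB; have [i hi] := dy z.
    have [<-|ic] := eqVneq i c; first by apply: hi; rewrite !inE eqxx.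
    have [e eE] := zB _ ic.
    by rewrite ltnNge hi // !inE eE orbT.
  apply/beyondP => i ic; exists (mn i) => //.
  have [j hj] := dy (mn i).
  have jy : key j (mn i) <= key j y by apply: hj; rewrite !inE eqxx.
  have ej : mn j = mn i.
    by apply: mn_eq => // e' e'E; apply: hj; rewrite !inE e'E orbT.
  have neq k : key k (mn i) <> key k y.
    by move=> /key_inj h; move: yE; rewrite -h mnE.
  have jc : j != c.
    apply/negP => /eqP jc; subst j.
    by apply: (neq c); apply/eqP; rewrite eqn_leq jy yc.
  have <- : j = i by apply: inj_c; rewrite ?inE.
  by rewrite ltn_neqAle; apply/andP; split; [rewrite ej; apply/eqP|rewrite ej].
exists a, b; split => //.
  rewrite -setI_eq0; apply/eqP/setP => y; rewrite !inE.
  apply/negP => /andP[/andP[ya _] /andP[yb _]].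
  have /beyondP ya' : y \in beyond E a by rewrite inE.
  have /beyondP yb' : y \in beyond E b by rewrite inE.
  have [i hi] := dominatedP _ dE y.
  have [ia|ia] := eqVneq i a.
    have ib : i != b by rewrite ia.
    by have [e eE] := yb' _ ib; rewrite ltnNge hi.
  by have [e eE] := ya' _ ia; rewrite ltnNge hi.
have ba : b != a by rewrite eq_sym.
apply/setP => y; rewrite inE in_setU; apply/andP/orP => [[yE dy]|[] yt].
- have [i hi] := dominatedP _ dy y.
  have hiE e : e \in E -> key i y <= key i e.
    by move=> eE; apply: hi; rewrite !inE eE orbT.
  have [ia|ia] := eqVneq i a; first by left; subst i; apply: (halfE a b).
  have [ib|ib] := eqVneq i b; first by right; subst i; apply: (halfE b a).
  (* Here [i] is neither [a] nor [b], so it is the only order in which [mn i] is minimal. Domination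
     of [mn i] then forces [y = mn i], which lies in [E]. *)
  exfalso; have [j hj] := dominatedP _ dy (mn i).
  have jy : key j (mn i) <= key j y by apply: hj; rewrite !inE eqxx.
  have ej : mn j = mn i.
    by apply: mn_eq => // e' e'E; apply: hj; rewrite !inE e'E orbT.
  have ji : j = i.
    have [inj_a _] := mn_injC _ _ ab eab.
    have [inj_b _] := mn_injC _ _ ba (esym eab).
    have [ja|ja] := eqVneq j a; last by apply: inj_a; rewrite ?inE.
    by apply: inj_b; rewrite ?inE // ja.
  have /key_inj h : key i (mn i) = key i y.
    by apply/eqP; rewrite eqn_leq hiE // -{1}ji -{2}ji jy.
  by move: yE; rewrite -h mnE.
- split; last exact: dominatedU1 yt.
  by move: yt; rewrite inE => /andP[+ _]; apply: half eab.
- split; last exact: dominatedU1 yt.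
  by move: yt; rewrite inE => /andP[+ _]; apply: half (esym eab).
Qed.

(* The slack element [s i] stands for the facet where coordinate [i] vanishes. *)
Section Slack.
Variable s : 'I_n -> T.
Hypothesis s_min : forall i y, key i (s i) <= key i y.
Hypothesis s_max : forall i k y,
  k != i -> y \notin codom s -> key i y < key i (s k).

Lemma card_door E y0 : y0 \in E -> y0 \notin codom s -> #|E|.+1 = n ->
  dominated E -> #|[set y | (y \notin E) && dominated (y |: E)]| = 2.
Proof.
move=> y0E y0s cE dE.
have E0 : E != set0 by apply/set0Pn; exists y0.
have [a [b [ab dab ->]]] := door_indices E0 cE dE.
have nz c : beyond E c != set0.
  apply/set0Pn; exists (s c); apply/beyondP => i ic; exists y0 => //.
  by apply: s_max; rewrite // eq_sym.
move: dab; rewrite -leq_card_setU => /eqP ->.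
by rewrite !card_argmax // !nz.
Qed.

(** This is the unique boundary door. Adding [s i0] would leave [x0] above the minimum in every
    order, so the only extension is by the non-slack element that is largest in order [i0]. *)
Lemma card_slack_door i0 x0 : x0 \notin codom s -> injective s ->
  let E := s @: [set~ i0] in
  dominated E /\ #|[set y | (y \notin E) && dominated (y |: E)]| = 1.
Proof.
move=> x0s s_inj E.
have lt_s i y : y \notin codom s -> key i (s i) < key i y.
  move=> ys; rewrite ltn_neqAle s_min andbT; apply/eqP => /key_inj h.
  by move: ys; rewrite -h codom_f.
split.
  apply/dominatedP => y; have [/codomP[i ->]|ys] := boolP (y \in codom s).
    by exists i => e _; apply: s_min.
  exists i0 => e /imsetP[i]; rewrite !inE => ii ->.
  by apply/ltnW/s_max.
have -> : [set y | (y \notin E) && dominated (y |: E)] =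
    [set y in ~: [set s i | i : 'I_n] |
      [forall z in ~: [set s i | i : 'I_n], key i0 z <= key i0 y]].
  have cs y : (y \in ~: [set s i | i : 'I_n]) = (y \notin codom s).
    rewrite inE; congr (~~ _); apply/imsetP/codomP => [[i _ ->]|[i ->]].
      by exists i.
    by exists i.
  apply/setP => y; rewrite in_set [RHS]in_set cs.
  apply/andP/andP => [[yE /dominatedP dy]|[ys /forall_inP ymax]].
    have ys : y \notin codom s.
      apply/negP => /codomP[i yi]; have ii : i = i0.
        apply/eqP; apply/negPn/negP => ii; move: yE; rewrite yi.
        by rewrite imset_f // !inE.
      have [j hj] := dy x0.
      have : key j x0 <= key j (s j).
        apply: hj; rewrite !inE; have [jj|jj] := eqVneq j i0.
          by rewrite yi ii jj eqxx.
        by rewrite [s j \in E]imset_f ?orbT // !inE.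
      by rewrite leqNgt lt_s.
    split=> //; apply/forall_inP => z; rewrite cs => zs.
    have [j hj] := dy z; have [jj|jj] := eqVneq j i0.
      by rewrite -jj; apply: hj; rewrite !inE eqxx.
    have : key j z <= key j (s j).
      by apply: hj; rewrite !inE [s j \in E]imset_f ?orbT // !inE.
    by rewrite leqNgt lt_s.
  split.
    by apply: contra ys => /imsetP[i _ ->]; rewrite codom_f.
  apply/dominatedP => z; have [/codomP[i ->]|zs] := boolP (z \in codom s).
    by exists i => e _; apply: s_min.
  exists i0 => e; rewrite !inE => /orP[/eqP->|]; first by apply: ymax; rewrite cs.
  by move=> /imsetP[i]; rewrite !inE => ii ->; apply/ltnW/s_max.
rewrite card_argmax //; apply/eqP; rewrite eqb1.
apply/set0Pn; exists x0; rewrite inE; apply: contra x0s => /imsetP[i _ ->].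
by rewrite codom_f.
Qed.

(** * Labellings and the parity count *)

Variable l : T -> 'I_n.
Hypothesis ls : forall i, l (s i) = i.

(** The doors: with [n - 1] elements and [n - 1] labels, every label other than [i0] occurs exactly
    once. *)
Let good i0 E := [&& #|E|.+1 == n, l @: E == [set~ i0] & dominated E].

(** If removing [y] leaves a door and [F] is not fully labelled, then [l y] repeats the label of
    exactly one other element [y']. Removing [y] or [y'] gives a door and no other removal does, so
    the count is 0 or 2. *)
Lemma even_doors i0 F : dominated F -> l @: F != [set: 'I_n] ->
  ~~ odd #|[set y in F | good i0 (F :\ y)]|.
Proof.
move=> dF lF; have [->|[y]] := set_0Vmem [set y in F | good i0 (F :\ y)].
  by rewrite cards0.
rewrite inE => /andP[yF /and3P[/eqP cy /eqP ly _]].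
have F_y : F = y |: F :\ y by rewrite setD1K.
have lyi : l y != i0.
  apply: contra lF => /eqP lyi; rewrite F_y imsetU1 ly lyi.
  by rewrite setUCr.
have : l y \in l @: (F :\ y) by rewrite ly !inE.
case/imsetP => y' y'F lyy'.
have /andP[y'y y'F'] : (y' != y) && (y' \in F) by move: y'F; rewrite !inE.
have card_good z : z \in F -> #|F :\ z|.+1 = n.
  move=> zF; rewrite -cy; have := cardsD1 y F; have := cardsD1 z F.
  by rewrite yF zF; lia.
have -> : [set y in F | good i0 (F :\ y)] = [set y; y'].
  apply/setP => z; rewrite !inE; apply/andP/orP => [[zF]|].
    case/and3P => _ /eqP lz _.
    have inj : {in F :\ z &, injective l}.
      apply/imset_injP; rewrite lz cardsC1 card_ord.
      by have := card_good _ zF; lia.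
    have [zy|zy] := eqVneq z y; first by left.
    have [zy'|zy'] := eqVneq z y'; first by right.
    exfalso; move: y'y; rewrite (inj _ _ _ _ lyy') ?eqxx // !inE.
      by rewrite eq_sym zy.
    by rewrite eq_sym zy'.
  move=> h; have zF : z \in F by case: h => /eqP ->.
  split=> //; apply/and3P; split.
  - by apply/eqP/card_good.
  - case: h => /eqP -> ; first by apply/eqP.
    apply/eqP; rewrite -ly; apply/setP => i.
    apply/imsetP/imsetP => [[x]|[x]]; rewrite !inE => /andP[xy xF] ->.
      have [->|xy2] := eqVneq x y; first by exists y'.
      by exists x => //; rewrite !inE xy2.
    have [->|xy2] := eqVneq x y'.
      by exists y => //; rewrite !inE eq_sym y'y.
    by exists x => //; rewrite !inE xy2.
  - exact: dominatedS (subsetDl _ _) dF.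
by rewrite cards2 eq_sym y'y.
Qed.

(** Pairs of a door [E] and an extension [y] are counted modulo 2. Grouped by [E], the boundary door
    contributes 1 and each other door 2. Grouped by [y |: E], the total would be even if no
    dominated set of size [n] were fully labelled. *)
Theorem scarf x0 (i0 : 'I_n) : x0 \notin codom s ->
  exists F, [/\ #|F| = n, dominated F & l @: F = [set: 'I_n]].
Proof.
move=> x0s.
have s_inj : injective s by move=> i j /(congr1 l); rewrite !ls.
have [/existsP[F /and3P[/eqP cF dF /eqP lF]]|] :=
  boolP [exists F : {set T}, [&& #|F| == n, dominated F & l @: F == [set: 'I_n]]].
  by exists F.
rewrite negb_exists => /forallP noF; exfalso.
pose doors := \sum_(E : {set T} | good i0 E)
  \sum_(y | (y \notin E) && dominated (y |: E)) 1.
have odd_doors : odd doors.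
  have [dE0 cE0] := card_slack_door i0 x0s s_inj.
  set E0 := s @: [set~ i0] in dE0 cE0.
  have cE0' : #|E0|.+1 = n.
    by rewrite card_imset // cardsC1 card_ord prednK // (leq_trans _ (ltn_ord i0)).
  have gE0 : good i0 E0.
    rewrite /good cE0' dE0 eqxx andbT /= -imset_comp.
    apply/eqP/setP => i; apply/imsetP/idP => [[j jj ->]|ii] /=.
      by rewrite ls.
    by exists i; rewrite /= ?ls.
  rewrite /doors (bigD1 E0) //= sum1dep_card cE0.
  rewrite (eq_bigr (fun=> 2)); last first.
    move=> E /andP[/and3P[/eqP cE /eqP lE dE] EE0].
    rewrite sum1dep_card.
    (* Otherwise [E] consists of slack elements only, and its labels force [E = E0]. *)
    have [y yE ys] : exists2 y, y \in E & y \notin codom s.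
      apply/exists_inP; apply: contraR EE0.
      rewrite negb_exists => /forallP h.
      have Es y : y \in E -> y = s (l y).
        move=> yE; have := h y; rewrite yE /= negbK => /codomP[i ->].
        by rewrite ls.
      apply/eqP/setP => y; apply/idP/imsetP => [yE|[i ii ->]].
        by exists (l y); [rewrite -lE imset_f|exact: Es].
      move: ii; rewrite -lE => /imsetP[z zE ->].
      by rewrite -Es.
    exact: card_door yE ys cE dE.
  by rewrite sum_nat_const oddD oddM andbF.
suff : ~~ odd doors by rewrite odd_doors.
have -> : doors = \sum_(F : {set T} | dominated F) #|[set y in F | good i0 (F :\ y)]|.
  rewrite /doors.
  under [RHS]eq_bigr do rewrite -sum1dep_card.
  rewrite [RHS](exchange_big_dep xpredT) //= (exchange_big_dep xpredT) //=.
  apply: eq_bigr => y _.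
  (* The pair of [E] and [y] corresponds to the pair of [F = y |: E] and [y], with [E = F :\ y]. *)
  rewrite (reindex_onto (fun F => F :\ y) (fun E => y |: E)) /=; last first.
    by move=> E /and3P[_ yE _]; rewrite setU1K.
  apply: eq_bigl => F; rewrite setD11 /=.
  have [yF|yF] := boolP (y \in F).
    by rewrite setD1K // eqxx andbT andbC.
  rewrite andbF; apply/negP => /andP[_ /eqP h].
  by move: yF; rewrite -h setU11.
elim/big_ind: _ => // [p q|F dF]; first by rewrite oddD => /negbTE -> /negbTE ->.
have [h|lF] := eqVneq (l @: F) [set: 'I_n]; last exact: even_doors.
suff -> : [set y in F | good i0 (F :\ y)] = set0 by rewrite cards0.
apply/setP => y; rewrite !inE; apply/negP => /andP[yF /and3P[/eqP cF _ _]].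
have := noF F; rewrite h dF eqxx !andbT => /eqP; apply.
by rewrite -cF (cardsD1 y F) yF.
Qed.

End Slack.
End Dominated.

(** * Sperner's lemma on a grid *)

Lemma ordS_closed n (C : {set 'I_n}) i0 : i0 \in C ->
  (forall i, i \in C -> ordS i \in C) -> forall i, i \in C.
Proof.
move=> i0C CS i.
have iterC k : iter k (@ordS n) i0 \in C by elim: k => //= k; exact: CS.
have val_iter k : val (iter k (@ordS n) i0) = (i0 + k) %% n.
  elim: k => [|k IH] /=; first by rewrite addn0 modn_small.
  by rewrite [X in X.+1]IH -addn1 modnDml addn1 addnS.
suff <- : iter (n - i0 + i) (@ordS n) i0 = i by [].
apply: val_inj; rewrite val_iter addnA subnKC ?modnDl ?modn_small //.
exact: ltnW.
Qed.

Section GridSperner.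
Variables n N : nat.
Hypothesis n_gt0 : 0 < n.

Definition grid := {x : {ffun 'I_n -> 'I_N.+1} | \sum_i x i == N}.

Lemma grid_of (y : 'I_n -> nat) : \sum_i y i = N ->
  exists x : grid, forall i, sval x i = y i :> nat.
Proof.
move=> sy; have yN i : y i < N.+1.
  by rewrite ltnS -sy (bigD1 i) //= leq_addr.
have h : \sum_i [ffun i => Ordinal (yN i)] i == N.
  by rewrite -[X in _ == X]sy; apply/eqP/eq_bigr => i _; rewrite ffunE.
by exists (exist (fun x : {ffun 'I_n -> 'I_N.+1} => \sum_i x i == N) _ h) => i; rewrite /= ffunE.
Qed.

(** Grid points are compared by coordinate [i], with ties broken by enumeration rank. The slack of
    [i] comes below all of them and the other slacks above. *)
Definition grid_key (i : 'I_n) (z : grid + 'I_n) : nat :=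
  match z with
  | inl x => (sval x i * #|{: grid}| + enum_rank x).+1
  | inr j => if j == i then 0 else (N.+1 * #|{: grid}| + j).+1
  end.

Lemma grid_key_lt i (x y : grid) : sval x i < sval y i ->
  grid_key i (inl x) < grid_key i (inl y).
Proof.
move=> xy; rewrite /= ltnS; have := ltn_ord (enum_rank x).
have : (sval x i).+1 * #|{: grid}| <= sval y i * #|{: grid}|.
  by rewrite leq_mul2r xy orbT.
rewrite mulSn => h1 h2; apply: leq_trans (leq_trans h1 (leq_addr _ _)).
by rewrite addnC ltn_add2r.
Qed.

Lemma grid_key_slack i j x : j != i ->
  grid_key i (inl x) < grid_key i (inr j).
Proof.
move=> ji; rewrite /= (negbTE ji) ltnS; have := ltn_ord (enum_rank x).
have : (sval x i).+1 * #|{: grid}| <= N.+1 * #|{: grid}|.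
  by rewrite leq_mul2r ltn_ord orbT.
rewrite mulSn => h1 h2; apply: leq_trans (leq_trans h1 (leq_addr _ _)).
by rewrite addnC ltn_add2r.
Qed.

Lemma grid_key_inj i : injective (grid_key i).
Proof.
move=> [x|j] [y|k].
- move=> h; congr inl; apply: enum_rank_inj.
  have [xy|xy|xy] := ltngtP (sval x i) (sval y i).
  + by have := grid_key_lt xy; rewrite h ltnn.
  + by have := grid_key_lt xy; rewrite h ltnn.
  + by move: h => /= [] /eqP; rewrite xy eqn_add2l => /eqP h; apply: val_inj.
- have [<-|ji] := eqVneq k i; first by rewrite /= eqxx.
  by move=> h; have := grid_key_slack x ji; rewrite h ltnn.
- have [<-|ji] := eqVneq j i; first by rewrite /= eqxx.
  by move=> h; have := grid_key_slack y ji; rewrite h ltnn.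
- rewrite /=; case: eqVneq => [->|ji]; case: eqVneq => [->|ki] // [].
  by move=> /eqP; rewrite eqn_add2l => /eqP h; congr inr; apply: val_inj.
Qed.

(* The label is shifted cyclically: a fully labelled dominated set then uses all
   indices, because the set of indices it uses is stable under [ordS]. *)
Lemma grid_sperner (l : {ffun 'I_n -> nat} -> 'I_n) :
  (forall (x : {ffun 'I_n -> nat}) j, \sum_i x i = N -> x j <= n -> l x != j) ->
  exists x : 'I_n -> {ffun 'I_n -> nat},
    [/\ forall i, \sum_j x i j = N, forall i, l (x i) = i &
        forall i k j, x i j <= x k j + n].
Proof.
move=> lP; pose i0 := Ordinal n_gt0.
pose nat_of (x : grid) : {ffun 'I_n -> nat} := [ffun i => nat_of_ord (sval x i)].
have sum_nat_of x : \sum_i nat_of x i = N.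
  by rewrite -[RHS](eqP (valP x)); apply: eq_bigr => i _; rewrite ffunE.
have [x0 _] : exists x0 : grid, forall i, sval x0 i = (if i == i0 then N else 0) :> nat.
  by apply: grid_of; rewrite -big_mkcond big_pred1_eq.
pose l' (z : grid + 'I_n) :=
  match z with inl x => ord_pred (l (nat_of x)) | inr j => j end.
have inlN (x : grid) : inl x \notin codom (inr : 'I_n -> grid + 'I_n).
  by apply/negP => /codomP[].
have s_max i k (z : grid + 'I_n) : k != i -> z \notin codom inr ->
    grid_key i z < grid_key i (inr k).
  case: z => [x ki _|j _]; first exact: grid_key_slack.
  by rewrite codom_f.
have s_min i (z : grid + 'I_n) : grid_key i (inr i) <= grid_key i z.
  by rewrite /= eqxx.
have [F [cF /dominatedP dF lF]] :=
  scarf grid_key_inj s_min s_max (fun i => erefl : l' (inr i) = i) i0 (inlN x0).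
(* Only orders in [C] can dominate a grid point, since the slack of [i] is below every grid point in
   order [i]. Conversely, a label in [C] must be carried by a grid point of [F]. *)
pose C := [set i | inr i \notin F].
have domC (y : grid) : exists2 i, i \in C &
    forall x : grid, inl x \in F -> sval y i <= sval x i.
  have [i hi] := dF (inl y); exists i.
    by rewrite inE; apply/negP => /hi; rewrite /= eqxx.
  by move=> x xF; rewrite leqNgt; apply/negP => /grid_key_lt; rewrite ltnNge hi.
have labelC i : i \in C -> exists2 x : grid, inl x \in F & l (nat_of x) = ordS i.
  rewrite inE => iF.
  have : i \in l' @: F by rewrite lF inE.
  case/imsetP => -[x|j] zF /= iE; last by move: iF; rewrite iE zF.
  by exists x; rewrite // iE ord_predK.
have [i1 i1C _] := domC x0.
have [x1 x1F _] := labelC _ i1C.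
pose arg i := [arg min_(x < x1 | inl x \in F) nat_of_ord (sval x i)].
have argF i : inl (arg i) \in F by rewrite /arg; case: arg_minnP.
pose m i := nat_of_ord (sval (arg i) i).
have m_min i (x : grid) : inl x \in F -> m i <= sval x i.
  by move=> xF; rewrite /m /arg; case: arg_minnP => // y _; apply.
(* Otherwise some grid point would exceed the minimum [m i] for every [i] in [C], against
   domination; the excess mass of this point is placed at [i1]. *)
have sum_m : N < \sum_(i in C) (m i).+1.
  rewrite ltnNge; apply/negP => mN.
  pose y i := if i \in C then (m i).+1 +
    (if i == i1 then N - \sum_(i in C) (m i).+1 else 0) else 0.
  have [gy gyE] : exists x : grid, forall i, sval x i = y i :> nat.
    apply: grid_of; rewrite /y -big_mkcond /= big_split /= -big_mkcondr /=.
    rewrite [X in _ + X](big_pred1 i1) ?subnKC // => i /=.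
    by case: eqVneq => [->|]; rewrite ?i1C ?andbF.
  have [i iC /(_ _ (argF i))] := domC gy.
  by rewrite gyE /y iC -[nat_of_ord _]/(m i) leqNgt addSn ltnS leq_addr.
have sumC (x : grid) :
    \sum_(i in C) nat_of_ord (sval x i) + \sum_(i | i \notin C) nat_of_ord (sval x i) = N.
  by rewrite -(bigID (mem C) predT) /=; apply/eqP/(valP x).
have sum_m' : N < \sum_(i in C) m i + n.
  apply: leq_trans sum_m _.
  under eq_bigr do rewrite -addn1.
  rewrite big_split /= leq_add2l sum1_card.
  by rewrite -[X in _ <= X]card_ord max_card.
(* The minima over [C] already take more than [N - n] of the total, which leaves less than [n] for
   the other coordinates. *)
have smallC (x : grid) i : inl x \in F -> i \notin C -> sval x i <= n.
  move=> xF iC; have := sumC x; rewrite [X in _ + X](bigD1 i) //=.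
  have : \sum_(i in C) m i <= \sum_(i in C) nat_of_ord (sval x i).
    by apply: leq_sum => j _; apply: m_min.
  have ar a b c d : N < b + n -> b <= a -> a + (c + d) = N -> c <= n by lia.
  exact: ar sum_m'.
have CT i : i \in C.
  apply: (ordS_closed i1C) => {}i iC; have [x xF lx] := labelC _ iC.
  apply/negPn/negP => /(smallC _ _ xF) small.
  by have := lP (nat_of x) (ordS i) (sum_nat_of x); rewrite ffunE lx eqxx => /(_ small).
have pick_x i : exists x : grid, (inl x \in F) && (l (nat_of x) == i).
  have [x xF lx] := labelC (ord_pred i) (CT _).
  by exists x; rewrite xF lx ord_predK eqxx.
exists (fun i => nat_of (xchoose (pick_x i))); split => [i|i|i k j].
- exact: sum_nat_of.
- by have /andP[_ /eqP] := xchooseP (pick_x i).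
have /andP[iF _] := xchooseP (pick_x i).
have /andP[kF _] := xchooseP (pick_x k).
rewrite !ffunE; set x := xchoose _ in iF *; set y := xchoose _ in kF *.
(* All coordinates are now at least their minima [m], which sum to more than [N - n]; hence none
   exceeds its minimum by [n]. *)
have := sumC x; rewrite (bigD1 j) //=.
have : \sum_(i in C | i != j) m i <= \sum_(i in C | i != j) nat_of_ord (sval x i).
  by apply: leq_sum => a _; apply: m_min.
have := m_min j _ kF; move: sum_m'; rewrite (bigD1 j) //=.
have ar a b c d e p : N < a + b + n -> a <= c -> b <= d -> e + d + p = N ->
  e <= c + n by lia.
exact: ar.
Qed.

End GridSperner.

From mathcomp Require Import all_order all_algebra.
From mathcomp Require Import all_classical all_reals all_analysis.
From mathcomp Require Import ring lra.
Import Order.TTheory GRing.Theory Num.Theory.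
Import numFieldNormedType.Exports.
Local Open Scope classical_set_scope.
Local Open Scope ring_scope.

(** * A nowhere vanishing field of normals *)

Section Dotv.
Variables (R : realType) (n : nat).
Implicit Types x y z : 'rV[R]_n.

Lemma dotvC x y : dotv x y = dotv y x.
Proof. by apply: eq_bigr => i _; rewrite mulrC. Qed.

Lemma dotvZr x a y : dotv x (a *: y) = a * dotv x y.
Proof. by rewrite /dotv mulr_sumr; apply: eq_bigr => i _; rewrite mxE mulrCA. Qed.

Lemma dotv0r x : dotv x 0 = 0.
Proof. by rewrite /dotv big1 // => i _; rewrite mxE mulr0. Qed.

Lemma dotv_sumr x (I : finType) (F : I -> 'rV[R]_n) :
  dotv x (\sum_i F i) = \sum_i dotv x (F i).
Proof.
rewrite /dotv exchange_big /=; apply: eq_bigr => i _.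
by rewrite summxE mulr_sumr.
Qed.

Lemma dotv_gt0 x : x != 0 -> 0 < dotv x x.
Proof.
move=> x0; rewrite lt_def sumr_ge0 ?andbT => [|i _]; last by rewrite -expr2 sqr_ge0.
apply: contra x0; rewrite psumr_eq0 => [|i _]; last by rewrite -expr2 sqr_ge0.
move=> /allP h; apply/eqP/rowP => i; rewrite mxE.
by have := h i (mem_index_enum _); rewrite mulf_eq0 orbb => /eqP.
Qed.

End Dotv.

(** * Vectors in general position *)

Section GenericVector.
Variable R : realType.

Lemma exists_nonroot (p : {poly R}) : p != 0 -> exists x, p.[x] != 0.
Proof.
move=> p0; pose rs : seq R := [seq i%:R | i <- iota 0 (size p)].
have urs : uniq rs.
  by rewrite map_inj_uniq ?iota_uniq // => i j /eqP; rewrite eqr_nat => /eqP.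
have [/(max_poly_roots p0) h|/allPn[x _ px]] := boolP (all (root p) rs).
  by have := h urs; rewrite size_map size_iota ltnn.
by exists x.
Qed.

Lemma exists_orthogonal n (k : nat) (v : 'I_k -> 'rV[R]_n) : (k < n)%N ->
  exists2 m : 'rV[R]_n, m != 0 & forall i, dotv (v i) m = 0.
Proof.
move=> kn; pose A := \matrix_(i < k, j < n) v i ord0 j.
have : kermx A^T != 0.
  rewrite -mxrank_eq0 mxrank_ker mxrank_tr subn_eq0 -ltnNge.
  exact: leq_ltn_trans (rank_leq_row _) kn.
move=> /rowV0Pn[m /sub_kermxP mA m0]; exists m => // i.
have := congr1 (fun M : 'rV_k => M ord0 i) mA; rewrite !mxE => <-.
by apply: eq_bigr => j _; rewrite !mxE mulrC.
Qed.

(* A point of the moment curve avoids the finitely many hyperplanes. *)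
Lemma exists_generic_vector n (I : finType) (W : I -> 'rV[R]_n) : (0 < n)%N ->
  exists c : 'rV[R]_n, forall g : 'I_n.-1 -> I,
    exists2 m : 'rV[R]_n, dotv c m != 0 & forall k, dotv (W (g k)) m = 0.
Proof.
move=> n0.
have orth (g : {ffun 'I_n.-1 -> I}) : exists m : 'rV[R]_n,
    m != 0 /\ forall k, dotv (W (g k)) m = 0.
  have [|m m0 h] := @exists_orthogonal n n.-1 (fun k => W (g k)).
    by rewrite prednK.
  by exists m.
have [m mP] := choice orth.
(* Evaluating the polynomial with coefficients [m g] at [x] gives the product of [m g] with the
   moment-curve point (1, x, x^2, ...), so a non-root of the product serves all [g] at once. *)
have p0 : \prod_(g : {ffun 'I_n.-1 -> I}) rVpoly (m g) != 0.
  apply/prodf_neq0 => g _; have [mg _] := mP g; apply: contra mg => /eqP h.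
  by rewrite -[m g]rVpolyK h linear0.
have [x] := exists_nonroot p0; rewrite horner_prod => /prodf_neq0 hx.
exists (\row_i x ^+ i) => g; exists (m [ffun k => g k]); last first.
  by move=> k; have [_ /(_ k)] := mP [ffun k => g k]; rewrite ffunE.
have := hx [ffun k => g k] isT; rewrite /rVpoly horner_poly.
congr (_ != _); apply: eq_bigr => i _; rewrite valK mxE mulrC //.
Qed.

End GenericVector.

(** * The weighted field of normals *)

Section NormalField.
Variables (R : realType) (n : nat).
Implicit Types (A : {set 'I_n}) (t : 'I_n -> R).

(** The second product is positive only if [A] is an upper level set of [t]. The empty set has
    weight 1, so [W] has to vanish there. *)
Definition face_weight A t : R :=
  (\prod_(i in A) t i) *
  \prod_(i in A) \prod_(j | j \notin A) Num.max 0 (t i - t j).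

Lemma face_weight_ge0 A t : (forall i, 0 <= t i) -> 0 <= face_weight A t.
Proof.
move=> t0; rewrite mulr_ge0 // prodr_ge0 // => i _.
by rewrite prodr_ge0 // => j _; rewrite le_max lexx.
Qed.

Lemma face_weight_gt0 A t : (forall i, 0 <= t i) ->
  reflect ((forall i, i \in A -> 0 < t i) /\
           (forall i j, i \in A -> j \notin A -> t j < t i))
          (0 < face_weight A t).
Proof.
move=> t0; rewrite lt_def face_weight_ge0 // andbT mulf_eq0 negb_or.
apply: (iffP andP) => -[].
  move=> /prodf_neq0 h1 /prodf_neq0 h2; split=> [i iA|i j iA jA].
    by rewrite lt_def h1 // t0.
  have /prodf_neq0/(_ j jA) := h2 i iA.
  by case: (ltP (t j)) => // ij; rewrite max_l ?subr_le0 // eqxx.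
move=> h1 h2; split; apply/prodf_neq0 => i iA.
  by rewrite gt_eqF // h1.
apply/prodf_neq0 => j jA; have ij : 0 < t i - t j by rewrite subr_gt0 h2.
by rewrite max_r ?gt_eqF // ltW.
Qed.

Variables (S : 'I_n -> set 'rV[R]_n) (W : {set 'I_n} -> 'rV[R]_n).
Hypothesis W0 : W finset.set0 = 0.
Hypothesis WS : forall A i j x y, A != finset.setT -> i \in A -> j \notin A ->
  S i x -> S j y -> dotv y (W A) < dotv x (W A).

Definition normal_field t := \sum_(A : {set 'I_n}) face_weight A t *: W A.

(** Take [i] with [t i] maximal. Every nonempty [A] of positive weight contains [i] and omits [j],
    so no term favours [j], and the set [M] of maximal coordinates gives strictness. *)
Lemma normal_field_face t j : (forall i, 0 <= t i) -> (exists i, 0 < t i) ->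
  t j = 0 -> exists i, forall x y, S i x -> S j y ->
    dotv y (normal_field t) < dotv x (normal_field t).
Proof.
move=> t0 [k tk] tj.
have [i _ imax] := @Order.TotalTheory.arg_maxP _ _ _ k xpredT t isT.
have {}imax a : t a <= t i by exact: imax.
have ti : 0 < t i by exact: lt_le_trans tk (imax k).
exists i => x y Six Sjy; rewrite !dotv_sumr.
have wA A : 0 < face_weight A t -> A != finset.set0 ->
    [/\ A != finset.setT, i \in A & j \notin A].
  move=> /(face_weight_gt0 _ t0)[h1 h2] /set0Pn[a aA].
  have jA : j \notin A by apply/negP => /h1; rewrite tj ltxx.
  split=> //; first by apply: contra jA => /eqP ->; rewrite finset.in_setT.
  by apply: contraT => iA; have := h2 _ _ aA iA; rewrite ltNge imax.
pose M := [set a | t a == t i]%SET.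
have MP : 0 < face_weight M t.
  apply/face_weight_gt0 => //; split=> [a|a b]; rewrite !inE.
    by move=> /eqP ->.
  move=> /eqP -> bi; rewrite lt_neqAle bi /=; exact: imax.
have M0 : M != finset.set0 by apply/set0Pn; exists i; rewrite inE.
rewrite (bigD1 M) //= [ltRHS](bigD1 M) //=.
have [MT iM jM] := wA _ MP M0.
apply: ltr_leD; first by rewrite !dotvZr ltr_pM2l // (WS MT iM jM).
apply: ler_sum => A _; rewrite !dotvZr.
have [->|A0] := eqVneq A finset.set0; first by rewrite W0 !dotv0r.
have [AP|] := ltP 0 (face_weight A t).
  by have [AT iA jA] := wA _ AP A0; rewrite ler_pM2l // ltW // (WS AT iA jA).
move=> hle; have -> : face_weight A t = 0.
  by apply: le_anti; rewrite hle face_weight_ge0.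
by rewrite !mul0r.
Qed.

Hypothesis WT : forall g : 'I_n.-1 -> {set 'I_n}, (forall k, g k != finset.setT) ->
    exists2 m : 'rV[R]_n, dotv (W finset.setT) m != 0 & forall k, dotv (W (g k)) m = 0.

(* The proper faces of positive weight form a chain, hence span at most [n - 1]
   dimensions. *)
Lemma normal_field_interior t : (forall i, 0 < t i) -> normal_field t != 0.
Proof.
move=> t_gt0; have t0 i : 0 <= t i by exact: ltW.
have chain A B : 0 < face_weight A t -> 0 < face_weight B t -> #|A| = #|B| ->
    A = B.
  move=> /(face_weight_gt0 _ t0)[_ hA] /(face_weight_gt0 _ t0)[_ hB] cAB.
  apply/eqP; rewrite eqEcard cAB leqnn andbT; apply/fintype.subsetP => a aA.
  apply: contraT => aB.
  have /fintype.subsetP BA : B \subset A.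
    apply/fintype.subsetP => b bB; apply: contraT => bA.
    by have := lt_trans (hA _ _ aA bA) (hB _ _ bB aB); rewrite ltxx.
  have : B \proper A by apply/fintype.properP; split; [exact/fintype.subsetP|exists a].
  by move=> /proper_card; rewrite cAB ltnn.
(* Sets of positive weight are determined by their size, so [g] lists the nonempty proper ones;
   sizes that do not occur get the harmless value [set0]. Pairing with a vector orthogonal to all of
   them isolates the term of the full set. *)
pose g (k : 'I_n.-1) : {set 'I_n} :=
  odflt finset.set0 [pick A : {set 'I_n} | (#|A| == k.+1) && (0 < face_weight A t)].
have gT k : g k != finset.setT.
  rewrite finset.eqEcard finset.subsetT /= finset.cardsT card_ord -ltnNge /g.
  have kn := ltn_ord k; case: pickP => [B /andP[/eqP -> _]|_] /=; first by lia.
  by rewrite finset.cards0; lia.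
have [m mT mg] := WT gT; apply: contra mT => /eqP w0.
have : dotv m (normal_field t) = 0 by rewrite w0 dotv0r.
rewrite dotv_sumr (bigD1 finset.setT) //= big1 ?addr0 => [|A AT]; last first.
  rewrite dotvZr; have [AP|hle] := ltP 0 (face_weight A t); last first.
    by rewrite (@le_anti _ R (face_weight A t) 0) ?mul0r // hle face_weight_ge0.
  have [->|A0] := eqVneq A finset.set0; first by rewrite W0 dotv0r mulr0.
  have cA0 : (0 < #|A|)%N by rewrite card_gt0.
  have cAn : (#|A|.-1 < n.-1)%N.
    have : A \proper finset.setT by rewrite finset.properEneq AT finset.subsetT.
    by move=> /proper_card; rewrite finset.cardsT card_ord; lia.
  have := mg (Ordinal cAn); rewrite /g /=.
  case: pickP => [B /andP[/eqP cB BP] /=|/(_ A)]; last by rewrite prednK // eqxx AP.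
  by rewrite (chain B A) ?cB ?prednK // dotvC => ->; rewrite mulr0.
rewrite dotvZr => /eqP; rewrite mulf_eq0 dotvC => /orP[|//].
rewrite gt_eqF //; apply/face_weight_gt0 => //; split=> // i j _.
by rewrite finset.in_setT.
Qed.

(** Genericity of the full-set normal settles interior points. On the boundary, the strict
    inequality between two images excludes the zero vector. *)
Lemma normal_field_neq0 t : (forall i, exists x, S i x) ->
  (forall i, 0 <= t i) -> (exists i, 0 < t i) -> normal_field t != 0.
Proof.
move=> Sn t0 tp; have [|] := boolP [forall i, 0 < t i].
  by move=> /forallP; exact: normal_field_interior.
rewrite negb_forall => /existsP[j]; rewrite lt_def t0 andbT negbK => /eqP tj.
have [i hi] := normal_field_face t0 tp tj; have [x Sx] := Sn i.
have [y Sy] := Sn j; have := hi _ _ Sx Sy.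
by apply: contraTneq => ->; rewrite !dotv0r ltxx.
Qed.

End NormalField.

(** * Hyperplanes are negligible *)

Section HyperplaneNull.
Variable R : realType.

(** The cover is continued by degenerate boxes at the origin, which have volume 0 in positive
    dimension. *)
Lemma lebesgue_null_finite_cover n (A : set 'rV[R]_n) : (0 < n)%N ->
  (forall eps : R, 0 < eps -> exists (I : finType) (a b : I -> 'rV[R]_n),
    [/\ forall k i, a k ord0 i <= b k ord0 i,
        forall x, A x -> exists k, forall i, a k ord0 i <= x ord0 i <= b k ord0 i &
        \sum_k box_vol (a k) (b k) <= eps]) ->
  lebesgue_null A.
Proof.
move=> n0 hA eps eps0; have [I [a [b [ab Acov vol]]]] := hA eps eps0.
pose ext (c : I -> 'rV[R]_n) (k : nat) : 'rV[R]_n :=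
  if insub k is Some o then c (enum_val (o : 'I_#|I|)) else 0.
have extE c (o : 'I_#|I|) : ext c o = c (enum_val o) by rewrite /ext valK.
have ext0 c k : ext c (#|I| + k)%N = 0.
  by rewrite /ext insubF // ltnNge leq_addr.
have ext_ab k i : ext a k ord0 i <= ext b k ord0 i.
  by rewrite /ext; case: insub => [p|] //; rewrite mxE.
have vol_ge0 k : 0 <= box_vol (ext a k) (ext b k).
  by apply: prodr_ge0 => i _; rewrite subr_ge0.
exists (ext a), (ext b); split=> //; split.
  move=> x /Acov[k xk]; exists (enum_rank k) => //=.
  by rewrite !extE enum_rankK.
move=> N; apply: le_trans vol.
have -> : \sum_k box_vol (a k) (b k) =
    \sum_(k < #|I|) box_vol (ext a k) (ext b k).
  rewrite (reindex _ (onW_bij _ (@enum_val_bij I))) /=.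
  by apply: eq_bigr => k _; rewrite !extE.
have -> : \sum_(k < #|I|) box_vol (ext a k) (ext b k) =
    \sum_(k < N + #|I|) box_vol (ext a k) (ext b k).
  rewrite addnC big_split_ord /= [X in _ = _ + X]big1 ?addr0 // => k _.
  by rewrite !ext0 /box_vol (bigD1 (Ordinal n0)) //= subrr mul0r.
by rewrite big_split_ord /= lerDl sumr_ge0.
Qed.

Lemma exists_grid_step (h y : R) K : 0 <= y -> y <= h * K.+1%:R ->
  exists z : 'I_K.+1, h * z%:R <= y <= h * z%:R + h.
Proof.
move=> y0; elim: K => [|K IH] yK.
  by exists ord0; rewrite mulr0 y0 add0r -[h]mulr1.
have [/IH[z hz]|yK'] := leP y (h * K.+1%:R).
  by exists (widen_ord (leqnSn _) z).
by exists ord_max; rewrite /= ltW //= -[X in _ + X]mulr1 -mulrDr natr1.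
Qed.

(** Over the coordinates other than [j] the hyperplane is a Lipschitz graph with constant [C].
    Cutting the base cube into cells of side [h] and placing a box of height [2 * C * h] over each
    covers it with total volume [V / K.+1]. *)
Lemma lebesgue_null_hyperplane n (v : 'rV[R]_n) (lam M : R) : v != 0 -> 0 < M ->
  lebesgue_null [set x : 'rV[R]_n | dotv x v = lam /\ forall i, `|x ord0 i| <= M].
Proof.
case: n v => [|n] v v0 M0.
  by move: v0; rewrite (thinmx0 v) eqxx.
have [j vj] : exists j, v ord0 j != 0.
  apply/existsP; apply: contraR v0; rewrite negb_exists => /forallP h.
  by apply/eqP/rowP => j; rewrite mxE; apply/eqP; have := h j; rewrite negbK.
apply: lebesgue_null_finite_cover => // eps eps0.
pose L : R := 2 * M.
pose C : R := (\sum_(i < n) `|v ord0 (lift j i)|) / `|v ord0 j|.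
have L0 : 0 < L by rewrite mulr_gt0.
have C0 : 0 <= C by rewrite divr_ge0 // sumr_ge0.
pose V : R := L ^+ n * (2 * C * L).
have V0 : 0 <= V.
  apply: mulr_ge0; first exact/exprn_ge0/ltW.
  by apply: mulr_ge0; [exact: mulr_ge0|exact: ltW].
pose K := (Num.truncn (V / eps)).
have KP : V / eps < K.+1%:R by exact: truncnS_gt.
have K0 : 0 < K.+1%:R :> R by rewrite ltr0n.
pose h : R := L / K.+1%:R.
have h0 : 0 < h by rewrite divr_gt0.
pose corner (z : {ffun 'I_n -> 'I_K.+1}) i : R := h * (z i)%:R - M.
(* The height of the hyperplane over the lower corner of the cell [z]. *)
pose cen z : R := (lam - \sum_i corner z i * v ord0 (lift j i)) / v ord0 j.
pose a z : 'rV[R]_n.+1 := \row_k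
  (if unlift j k is Some i then corner z i else cen z - C * h).
pose b z : 'rV[R]_n.+1 := \row_k
  (if unlift j k is Some i then corner z i + h else cen z + C * h).
exists {ffun 'I_n -> 'I_K.+1}, a, b; split.
- move=> z k; rewrite !mxE; case: unliftP => [i _|_]; first by rewrite lerDl ltW.
  by rewrite lerD2l ge0_cp // mulr_ge0 // ltW.
- move=> x [xv xM].
  have step (i : 'I_n) : exists z : 'I_K.+1,
      h * z%:R <= x ord0 (lift j i) + M <= h * z%:R + h.
    apply: exists_grid_step; first by have := xM (lift j i); rewrite ler_norml; lra.
    rewrite /h divfK ?gt_eqF //.
    by have := xM (lift j i); rewrite ler_norml /L; lra.
  have [z zP] := choice step; exists [ffun i => z i] => k; rewrite !mxE.
  have cE i : corner [ffun i => z i] i = h * (z i)%:R - M by rewrite /corner ffunE.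
  case: unliftP => [i ->|->]; first by rewrite cE; have := zP i; lra.
  suff : `|x ord0 j - cen [ffun i => z i]| <= C * h by rewrite ler_norml; lra.
  have -> : x ord0 j - cen [ffun i => z i] =
    (\sum_i (corner [ffun i => z i] i - x ord0 (lift j i)) * v ord0 (lift j i)) / v ord0 j.
    rewrite /cen -xv /dotv (bigD1_ord j) //=.
    under [in RHS]eq_bigr do rewrite mulrBl.
    rewrite sumrB -[x ord0 j in LHS](mulfK vj) -mulrBl; congr (_ / _).
    by rewrite (mulfK vj); ring.
  rewrite normrM normfV /C mulrAC ler_pM2r ?invr_gt0 ?normr_gt0 //.
  apply: le_trans (ler_norm_sum _ _ _) _; rewrite mulr_suml.
  apply: ler_sum => i _; rewrite normrM mulrC ler_wpM2l // cE ler_norml.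
  by have := zP i; lra.
- have volE z : box_vol (a z) (b z) = 2 * C * h * h ^+ n.
    rewrite /box_vol (bigD1_ord j) //= !mxE unlift_none; congr (_ * _); first by lra.
    under eq_bigr => i _ do rewrite !mxE liftK (addrC (corner z i)) addrK.
    by rewrite prodr_const card_ord.
  under eq_bigr do rewrite volE.
  rewrite sumr_const card_ffun !card_ord -[_ *+ (_ ^ _)]mulr_natr natrX.
  have -> : 2 * C * h * h ^+ n * K.+1%:R ^+ n = V / K.+1%:R.
    by rewrite -mulrA -exprMn /h divfK ?gt_eqF // /V; ring.
  by rewrite ler_pdivrMr // -ler_pdivrMl // mulrC ltW.
Qed.

End HyperplaneNull.

(** * Closed graph of the admissible levels *)

Section ClosedGraph.
Variables (R : realType) (n : nat).
Implicit Types (u v x : 'rV[R]_n) (l lam : R).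

Definition norm1 x : R := \sum_(i < n) `|x ord0 i|.

Lemma norm1_ge0 x : 0 <= norm1 x. Proof. exact: sumr_ge0. Qed.

Lemma coord_le_norm1 x i : `|x ord0 i| <= norm1 x.
Proof. by rewrite /norm1 (bigD1 i) //= lerDl sumr_ge0. Qed.

Lemma dotv_le_norm1 x v (d : R) : (forall i, `|v ord0 i| <= d) ->
  `|dotv x v| <= d * norm1 x.
Proof.
move=> vd; apply: le_trans (ler_norm_sum _ _ _) _; rewrite mulr_sumr.
by apply: ler_sum => i _; rewrite normrM mulrC ler_wpM2r.
Qed.

Lemma cvg_sum (T : Type) (F : set_system T) {FF : Filter F} (I : Type) (r : seq I)
    (P : pred I) (f : I -> T -> R) (a : I -> R) :
  (forall i, P i -> f i x @[x --> F] --> a i) ->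
  \sum_(i <- r | P i) f i x @[x --> F] --> \sum_(i <- r | P i) a i.
Proof. by apply: cvg_big; exact: add_continuous. Qed.

Lemma cvg_prod (T : Type) (F : set_system T) {FF : Filter F} (I : Type) (r : seq I)
    (P : pred I) (f : I -> T -> R) (a : I -> R) :
  (forall i, P i -> f i x @[x --> F] --> a i) ->
  \prod_(i <- r | P i) f i x @[x --> F] --> \prod_(i <- r | P i) a i.
Proof. by apply: cvg_big; exact: mul_continuous. Qed.

Lemma continuous_dotv v : continuous (fun x => dotv x v).
Proof.
move=> x; apply: (cvg_sum (F := nbhs x)) => i _.
by apply: cvgM; [exact: coord_continuous|exact: cvg_cst].
Qed.

Lemma continuous_norm1 : continuous norm1.
Proof.
move=> x; apply: (cvg_sum (F := nbhs x)) => i _.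
by apply: cvg_norm; exact: coord_continuous.
Qed.

Lemma closed_measurable (A : set 'rV[R]_n) : closed A ->
  measurable (A : set (borelRn R n)).
Proof.
move=> cA; rewrite -[A]setCK; apply: measurableC.
by apply: sub_sigma_algebra; exact: closed_openC.
Qed.

Lemma closed_le_continuous (g h : 'rV[R]_n -> R) : continuous g -> continuous h ->
  closed [set x | g x <= h x].
Proof.
move=> cg ch.
have -> : [set x | g x <= h x] = (h \- g) @^-1` [set r | 0 <= r].
  by apply/seteqP; split=> x /=; rewrite subr_ge0.
apply: preimage_closed; last exact: closed_ge.
by move=> x _; exact: cvgB (ch x) (cg x).
Qed.

Lemma measurable_hplus v lam : measurable (hplus v lam : set (borelRn R n)).
Proof.
apply: closed_measurable; apply: closed_le_continuous => //; last exact: continuous_dotv.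
by exact: cst_continuous.
Qed.

Variable mu : probability (borelRn R n) R.
Hypothesis mu_cont : continuous_prob mu.

Lemma measure_hyperplane0 v lam : v != 0 ->
  mu ([set x | dotv x v = lam] : set (borelRn R n)) = 0%E.
Proof.
move=> v0.
have eqE : [set x | dotv x v = lam] = [set x | lam <= dotv x v] `&` [set x | dotv x v <= lam].
  by apply/seteqP; split=> [x /= ->|x /= [h1 h2]]; rewrite ?lexx //; apply: le_anti; rewrite h1 h2.
have clH : closed [set x | dotv x v = lam].
  rewrite eqE; apply: closedI; apply: closed_le_continuous; try exact: continuous_dotv;
  by exact: cst_continuous.
apply: measure_negligible; first exact: closed_measurable.
(* The null-cover lemma treats bounded pieces, so the hyperplane is exhausted by countably many of
   them. *)
pose F (k : nat) : set (borelRn R n) :=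
  [set x | dotv x v = lam] `&` [set x | norm1 x <= k.+1%:R].
have -> : [set x | dotv x v = lam] = \bigcup_k F k.
  apply/seteqP; split=> [x xv|x [k _ []//]].
  exists (Num.truncn (norm1 x)) => //; split=> //=.
  by apply/ltW/truncnS_gt.
apply: negligible_bigcup => k; apply/negligibleP.
  apply: closed_measurable; apply: closedI => //.
  by apply: closed_le_continuous; [exact: continuous_norm1|exact: cst_continuous].
have Fm : measurable (F k).
  apply: closed_measurable; apply: closedI => //.
  by apply: closed_le_continuous; [exact: continuous_norm1|exact: cst_continuous].
apply: mu_cont => // eps eps0.
have [|a [b [ab [cov vol]]]] := @lebesgue_null_hyperplane R n v lam k.+1%:R v0 _ eps eps0.
  by rewrite ltr0n.
exists a, b; split=> //; split=> //; apply: subset_trans cov => x [xv xk]; split=> // i.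
exact: le_trans (coord_le_norm1 x i) xk.
Qed.

(** Contains all points on which two half-spaces can disagree when their normals, coordinatewise,
    and their levels are within [k.+1%:R^-1]. The width grows with [norm1 x] because tilting moves
    distant points further. *)
Let wedge v lam (k : nat) : set (borelRn R n) :=
  [set x | `|dotv x v - lam| <= k.+1%:R^-1 * (1 + norm1 x)].

Lemma measurable_wedge v lam k : measurable (wedge v lam k).
Proof.
apply: closed_measurable.
apply: closed_le_continuous => x.
  exact: cvg_norm (cvgB (@continuous_dotv v x) (cvg_cst lam)).
apply: (@cvgM _ _ (nbhs x)); first exact: cvg_cst.
apply: (@cvgD _ _ _ (nbhs x)); [exact: cvg_cst|exact: continuous_norm1].
Qed.

(** The wedges decrease to the hyperplane, which is null, so continuity from above applies. *)
Lemma measure_wedge_small v lam (e : R) : v != 0 -> 0 < e ->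
  exists k, (mu (wedge v lam k) <= e%:E)%E.
Proof.
move=> v0 e0.
have capE : \bigcap_k wedge v lam k = [set x | dotv x v = lam].
  apply/seteqP; split=> [x h|x /= xv k _]; last first.
    by rewrite /wedge /= xv subrr normr0 mulr_ge0 // addr_ge0 // norm1_ge0.
  apply/eqP; rewrite -subr_eq0 -normr_le0; apply/ler_addgt0Pr => d d0; rewrite add0r.
  have n0 : 0 < 1 + norm1 x by rewrite ltr_pwDl // norm1_ge0.
  pose k := Num.truncn ((1 + norm1 x) / d).
  apply: le_trans (h k I) _; rewrite ler_pdivrMl // -ler_pdivrMr //.
  exact/ltW/truncnS_gt.
have cvg : (mu \o wedge v lam) k @[k --> \oo] --> mu (\bigcap_k wedge v lam k).
  apply: nonincreasing_cvg_mu => //.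
  - by rewrite (le_lt_trans (probability_le1 _ _)) ?ltry //; exact: measurable_wedge.
  - by move=> k; exact: measurable_wedge.
  - by apply: bigcap_measurable => // k _; exact: measurable_wedge.
  - move=> k l kl; apply/subsetPset => x /= h; apply: le_trans h _.
    by rewrite ler_wpM2r ?addr_ge0 ?norm1_ge0 // lef_pV2 ?posrE ?ltr0n // ler_nat.
rewrite capE measure_hyperplane0 // in cvg.
have : \forall k \near \oo, ((mu \o wedge v lam) k < e%:E)%E.
  apply: (cvg [set y | (y < e%:E)%E]); apply: open_nbhs_nbhs.
  by split; [exact: open_ereal_lt_ereal|rewrite /= lte_fin].
by move=> [k _ /(_ k (leqnn k)) h]; exists k; exact/ltW.
Qed.

Lemma hplus_sub_wedge u v l lam (k : nat) : (forall i, `|u ord0 i - v ord0 i| <= k.+1%:R^-1) ->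
  `|l - lam| <= k.+1%:R^-1 ->
  hplus u l `<=` hplus v lam `|` wedge v lam k /\
  hplus v lam `<=` hplus u l `|` wedge v lam k.
Proof.
move=> uv ll.
have key x : `|dotv x u - dotv x v| <= k.+1%:R^-1 * norm1 x.
  have -> : dotv x u - dotv x v = dotv x (u - v).
    by rewrite /dotv -sumrB; apply: eq_bigr => i _; rewrite !mxE mulrBr.
  by apply: dotv_le_norm1 => i; rewrite !mxE.
have bnd x : 0 <= k.+1%:R^-1 * norm1 x by rewrite mulr_ge0 // norm1_ge0.
(* If the two half-spaces disagree at a point, its distance in level from the second is at most the
   sum of the two perturbations. *)
have close (a b c e d m : R) : `|a - b| <= d * m -> `|c - e| <= d ->
    0 <= d * m -> (b < e /\ c <= a) \/ (a < c /\ e <= b) ->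
    `|b - e| <= d * (1 + m).
  by rewrite !ler_norml mulrDr mulr1 => ? ? ? [[? ?]|[? ?]]; lra.
split=> x; rewrite /hplus /wedge /= => hx.
  have [h|h] := leP lam (dotv x v); [by left|right].
  exact: close (key x) ll (bnd x) (or_introl (conj h hx)).
have [h|h] := leP l (dotv x u); [by left|right].
exact: close (key x) ll (bnd x) (or_intror (conj h hx)).
Qed.

(** Up to a wedge of measure at most [e], each of the two half-spaces contains the other, so their
    measures differ by at most [e]. *)
Lemma hplus_closed_graph v lam (alpha : R) : v != 0 ->
  (forall d : R, 0 < d -> exists (u : 'rV[R]_n) (l : R), [/\ forall i, `|u ord0 i - v ord0 i| <= d,
     `|l - lam| <= d & mu (hplus u l : set (borelRn R n)) = alpha%:E]) ->
  mu (hplus v lam : set (borelRn R n)) = alpha%:E.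
Proof.
move=> v0 happ.
have sub (A B C : set (borelRn R n)) : measurable A -> measurable B -> measurable C ->
    A `<=` B `|` C -> (mu A <= mu B + mu C)%E.
  move=> mA mB mC ABC; apply: le_trans (measureU2 _ mB mC).
  by apply: le_measure => //; rewrite inE //; exact: measurableU.
apply/eqP; rewrite eq_le; apply/andP; split; apply/lee_addgt0Pr => e e0.
  have [k hk] := measure_wedge_small lam v0 e0.
  have [|u [l [uv ll <-]]] := happ k.+1%:R^-1; first by rewrite invr_gt0.
  have [_ /sub h] := hplus_sub_wedge uv ll.
  apply: le_trans (h _ _ _) _; rewrite ?leeD2l //;
    [exact: measurable_hplus|exact: measurable_hplus|exact: measurable_wedge].
have [k hk] := measure_wedge_small lam v0 e0.
have [|u [l [uv ll <-]]] := happ k.+1%:R^-1; first by rewrite invr_gt0.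
have [/sub h _] := hplus_sub_wedge uv ll.
apply: le_trans (h _ _ _) _; rewrite ?leeD2l //;
  [exact: measurable_hplus|exact: measurable_hplus|exact: measurable_wedge].
Qed.

End ClosedGraph.

(** * Passage to the limit *)

(** Compactness gives a cluster point, and along an ultrafilter a cluster point is a limit. This
    replaces repeated extraction of subsequences. *)
Lemma ultra_bounded_cvg (R : realType) (T : Type) (U : set_system T) (g : T -> R)
    (M : R) : UltraFilter U -> (forall k, `|g k| <= M) ->
  exists l : R, g k @[k --> U] --> l.
Proof.
move=> UU gM; have PF : ProperFilter (g k @[k --> U]) by exact: fmap_proper_filter.
have [|l [_ cl]] := @segment_compact R (- M) M _ PF.
  by apply: (@filterE _ U) => k /=; rewrite in_itv /= -ler_norml.
exists l => B nB; have [//|UC] := in_ultra_setVsetC (g @^-1` B) UU.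
by have [y []] := cl (~` B) B UC nB.
Qed.

(** * Continuity of the unit normal *)

Section NormalFieldLimit.
Variables (R : realType) (n : nat).

Definition unit_of (w : 'rV[R]_n) : 'rV[R]_n := (Num.sqrt (dotv w w))^-1 *: w.

Lemma sphere_unit_of w : w != 0 -> sphere (unit_of w).
Proof.
move=> /dotv_gt0 w0; rewrite /sphere /= /unit_of dotvZr dotvC dotvZr mulrA -expr2.
by rewrite exprVn sqr_sqrtr ?ltW // mulVf // gt_eqF.
Qed.

Lemma cvg_normal_field (T : Type) (F : set_system T) {FF : Filter F}
    (W : {set 'I_n} -> 'rV[R]_n) (u : T -> 'I_n -> R) (t : 'I_n -> R) l :
  (forall i, u k i @[k --> F] --> t i) ->
  normal_field W (u k) ord0 l @[k --> F] --> normal_field W t ord0 l.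
Proof.
move=> ut; rewrite /normal_field summxE; under eq_cvg do rewrite summxE.
apply: cvg_sum => A _; rewrite mxE; under eq_cvg do rewrite mxE.
apply: cvgM; last exact: cvg_cst.
apply: cvgM; first by apply: cvg_prod => i _; exact: ut.
apply: cvg_prod => i _; apply: cvg_prod => j _; rewrite maxr_absE.
under eq_cvg do rewrite maxr_absE.
apply: cvgM; last exact: cvg_cst.
have c : u k i - u k j @[k --> F] --> t i - t j by exact: cvgB.
apply: cvgD; first by apply: cvgD => //; exact: cvg_cst.
by apply: cvg_norm; apply: cvgB => //; exact: cvg_cst.
Qed.

Lemma cvg_unit_of (T : Type) (F : set_system T) {FF : Filter F}
    (w : T -> 'rV[R]_n) (w0 : 'rV[R]_n) l : w0 != 0 ->
  (forall i, w k ord0 i @[k --> F] --> w0 ord0 i) ->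
  unit_of (w k) ord0 l @[k --> F] --> unit_of w0 ord0 l.
Proof.
move=> w00 cw; rewrite /unit_of mxE; under eq_cvg do rewrite mxE.
apply: cvgM; last exact: cw.
apply: cvgV; first by rewrite gt_eqF // sqrtr_gt0 dotv_gt0.
apply: continuous_cvg; first exact: sqrt_continuous.
by apply: cvg_sum => i _; apply: cvgM; exact: cw.
Qed.

End NormalFieldLimit.

(** Separation concerns nonempty proper [A], so the two remaining values can be prescribed: 0 at the
    empty set, and at the full set a vector generic with respect to all the others. *)
Lemma exists_separating_normals (R : realType) n (S : 'I_n -> set 'rV[R]_n) :
  (0 < n)%N -> separable_by_hyperplanes S ->
  exists W : {set 'I_n} -> 'rV[R]_n, [/\ W finset.set0 = 0,
    forall A i j x y, A != finset.setT -> i \in A -> j \notin A ->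
      S i x -> S j y -> dotv y (W A) < dotv x (W A) &
    forall g : 'I_n.-1 -> {set 'I_n}, (forall k, g k != finset.setT) ->
      exists2 m : 'rV[R]_n, dotv (W finset.setT) m != 0 &
        forall k, dotv (W (g k)) m = 0].
Proof.
move=> n0 sepS.
have sepA (A : {set 'I_n}) : exists w : 'rV[R]_n, forall i j x y,
    i \in A -> j \notin A -> S i x -> S j y -> dotv y w < dotv x w.
  have [w [lam [_ h]]] := sepS (fun i => i \in A); exists w => i j x y iA jA Six Sjy.
  by have := h i x Six; have := h j y Sjy; rewrite iA (negbTE jA); exact: lt_trans.
have [W0 W0P] := choice sepA.
pose W1 A := if A == finset.set0 then 0 else W0 A.
have [c cP] := exists_generic_vector W1 n0.
have T0 : (finset.set0 == [set: 'I_n]%SET) = false.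
  apply/negP => /eqP/(congr1 (fun A : {set 'I_n} => #|A|)).
  by rewrite finset.cards0 finset.cardsT card_ord => h; move: n0; rewrite -h.
exists (fun A => if A == finset.setT then c else W1 A); split.
- by rewrite T0 /W1 eqxx.
- move=> A i j x y /negbTE -> iA jA Six Sjy; rewrite /W1 ifN; first exact: W0P iA jA _ _.
  by apply/set0Pn; exists i.
- move=> g gT; have [m mc mg] := cP g; exists m; rewrite ?eqxx // => k.
  by rewrite (negbTE (gT k)).
Qed.

(* Helly's theorem on the line, for the intervals spanned by the columns of [gam]. *)
Lemma exists_common_level (R : realType) n (gam : 'I_n -> 'I_n -> R) : (0 < n)%N ->
  (forall i j, gam i j <= gam i i) ->
  exists lam, forall j, exists i i', gam i j <= lam <= gam i' j.
Proof.
move=> n0 gle; pose i0 := Ordinal n0.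
pose am j := [arg min_(i < i0) gam i j]%O.
have amP i j : gam (am j) j <= gam i j.
  by rewrite /am; case: Order.TotalTheory.arg_minP => // k _; apply.
pose jm := [arg max_(j > i0) gam (am j) j]%O.
have jmP j : gam (am j) j <= gam (am jm) jm.
  by rewrite /jm; case: Order.TotalTheory.arg_maxP => // k _; apply.
(* The largest of the column minima. It is at most [gam j jm], hence at most the diagonal entry
   [gam j j]. *)
exists (gam (am jm) jm) => j; exists (am j), j; rewrite jmP /=.
exact: le_trans (amP j jm) (gle j jm).
Qed.

Theorem mainTheorem1 (R : realType) (n : nat) (hn : (0 < n)%N)
    (mu : 'I_n -> probability (borelRn R n) R)
    (alpha : 'I_n -> R)
    (f : 'I_n -> 'rV[R]_n -> 'rV[R]_n)
    (hmu : forall i, continuous_prob (mu i))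
    (halpha : forall i, 0 <= alpha i <= 1)
    (hf : forall i (v : 'rV[R]_n), sphere v ->
            mu i (hplus v (dotv v (f i v)) : set (borelRn R n)) = (alpha i)%:E)
    (hbdd : forall i, exists M : R, forall v, sphere v ->
            forall j : 'I_n, `|f i v ord0 j| <= M)
    (hsep : separable_by_hyperplanes (fun i => f i @` (@sphere R n))) :
  exists (v : 'rV[R]_n) (lam : R), v != 0 /\
    forall i, mu i (hplus v lam : set (borelRn R n)) = (alpha i)%:E.
Proof.
have [W [W0 WS WT]] := exists_separating_normals hn hsep.
pose i0 := Ordinal hn.
pose S i := f i @` (@sphere R n).
have Sn i : exists x, S i x.
  exists (f i (unit_of (delta_mx ord0 i0))); exists (unit_of (delta_mx ord0 i0)) => //.
  apply: sphere_unit_of; apply/eqP => /rowP/(_ i0)/eqP.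
  by rewrite !mxE !eqxx oner_eq0.
pose g j w := dotv (unit_of w) (f j (unit_of w)).
(* Truncating [n] coordinates by [n] removes at most [n * n], so the term [2 * (n * n)] keeps at
   least half of the mass; [k] refines the grid. *)
pose den k : nat := (2 * (n * n) + k).+1.
(* The truncated subtraction moves grid points close to a face onto that face. *)
pose u k (x : {ffun 'I_n -> nat}) i : R := (x i - n)%:R / (den k)%:R.
pose lab k x := [arg max_(i > i0) g i (normal_field W (u k x))]%O.
have labP k x j : g j (normal_field W (u k x)) <= g (lab k x) (normal_field W (u k x)).
  by rewrite /lab; case: Order.TotalTheory.arg_maxP => // i _; apply.
have den0 k : 0 < (den k)%:R :> R by rewrite ltr0n.
have u0 k x i : 0 <= u k x i by rewrite divr_ge0.
have sum_u k (x : {ffun 'I_n -> nat}) : (\sum_i x i = den k)%N -> 1 / 2 <= \sum_i u k x i.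
  move=> sx; rewrite -mulr_suml -natr_sum ler_pdivlMr //.
  have h : (den k <= \sum_i (x i - n) + n * n)%N.
    rewrite -sx -[X in (_ + X * _)%N]card_ord -sum_nat_const -big_split /=.
    by apply: leq_sum => i _; rewrite addnC -leq_subLR.
  have h2 : (den k <= 2 * \sum_i (x i - n))%N by move: h; rewrite /den; lia.
  by move: h2; rewrite -(ler_nat R) natrM; lra.
have u_gt0 k (x : {ffun 'I_n -> nat}) : (\sum_i x i = den k)%N -> exists i, 0 < u k x i.
  move=> /sum_u su; apply/existsP; apply: contraTT su; rewrite negb_exists => /forallP h.
  rewrite big1 => [|i _]; first by rewrite -ltNge; lra.
  by apply: le_anti; rewrite u0 andbT leNgt h.
have wn0 k (x : {ffun 'I_n -> nat}) : (\sum_i x i = den k)%N -> normal_field W (u k x) != 0.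
  by move=> sx; apply: (normal_field_neq0 W0 WS WT Sn) => //; exact: u_gt0.
have sperner k : exists X : 'I_n -> {ffun 'I_n -> nat},
    [/\ forall i, (\sum_j X i j)%N = den k, forall i, lab k (X i) = i &
        forall i i' j, (X i j <= X i' j + n)%N].
  (* If [x j <= n], the truncated point lies on the face [j], where some index [i] has a strictly
     higher level, so [j] is not the label. *)
  apply: grid_sperner => // x j sx xj; apply/eqP => lj.
  have uj : u k x j = 0 by rewrite /u (eqP xj) mul0r.
  have [i hi] := normal_field_face W0 WS (u0 k x) (u_gt0 _ _ sx) uj.
  have sw := sphere_unit_of (wn0 _ _ sx).
  have := labP k x i; rewrite lj leNgt /g -![dotv (unit_of _) _]dotvC !dotvZr.
  rewrite ltr_pM2l ?invr_gt0 ?sqrtr_gt0 ?dotv_gt0 ?wn0 // => /negP; apply.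
  by apply: hi; [exists (unit_of (normal_field W (u k x)))
                |exists (unit_of (normal_field W (u k x)))].
have [X XP] := choice sperner.
have sX k i : (\sum_j X k i j)%N = den k by have [] := XP k.
(* One ultrafilter finer than the filter at infinity makes all the bounded sequences below converge
   together. *)
have [U [UU Uoo]] := ultraFilterLemma eventually_filter.
have UF : ProperFilter U by exact: ultra_proper.
have u_le1 k i j : `|u k (X k i) j| <= 1.
  rewrite ger0_norm // ler_pdivrMr // mul1r ler_nat -(sX k i) (bigD1 j) //=.
  by rewrite (leq_trans (leq_subr _ _)) // leq_addr.
have lim_u j : exists l : R, u k (X k i0) j @[k --> U] --> l.
  exact: ultra_bounded_cvg (fun k => u_le1 k i0 j).
have [t tP0] := choice lim_u.
(* Points of different labels differ by at most [n / den k] in each scaled coordinate, so they share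
   the limit [t]. *)
have tP i j : u k (X k i) j @[k --> U] --> t j.
  have -> : t j = t j + 0 by rewrite addr0.
  have -> : (fun k => u k (X k i) j) =
      (fun k => u k (X k i0) j + (u k (X k i) j - u k (X k i0) j)).
    by apply/funext => k; rewrite addrC subrK.
  apply: cvgD; first exact: tP0.
  apply/cvgrPdist_le => e e0; apply: Uoo.
  exists (Num.truncn (n%:R / e)) => // k /= kn.
  rewrite sub0r normrN -mulrBl normrM [`|_^-1|]ger0_norm // ler_pdivrMr //.
  have ke : n%:R <= e * (den k)%:R.
    rewrite -ler_pdivrMl // mulrC; apply: le_trans (ltW (truncnS_gt _)) _.
    by rewrite ler_nat ltnS (leq_trans kn) // leq_addl.
  apply: le_trans ke; have [_ _ h] := XP k; rewrite ler_norml.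
  have := h i i0 j; have := h i0 i j; set a := X k i j; set b := X k i0 j => h1 h2.
  have {}h1 : (b - n <= a - n + n)%N by lia.
  have {}h2 : (a - n <= b - n + n)%N by lia.
  by move: h1 h2; rewrite -!(ler_nat R) !natrD; lra.
have t0 j : 0 <= t j.
  by apply: (cvgr_to_ge (tP0 j)); apply: nearW => k.
have t_gt0 : exists j, 0 < t j.
  have : 1 / 2 <= \sum_j t j.
    apply: (@cvgr_to_ge _ U _ R (fun k => \sum_j u k (X k i0) j)).
      by apply: cvg_sum => j _; exact: tP0.
    by apply: nearW => k; exact: sum_u.
  move=> st; apply/existsP; apply: contraTT st; rewrite negb_exists => /forallP h.
  rewrite big1 => [|i _]; first by rewrite -ltNge; lra.
  by apply: le_anti; rewrite t0 andbT leNgt h.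
have wt0 := normal_field_neq0 W0 WS WT Sn t0 t_gt0.
pose v := unit_of (normal_field W t).
have sv : sphere v by exact: sphere_unit_of.
have v0 : v != 0.
  by apply/eqP => v0; move: sv; rewrite /sphere /= v0 dotv0r => /esym/eqP; rewrite oner_eq0.
pose a k i := unit_of (normal_field W (u k (X k i))).
have sa k i : sphere (a k i) by exact/sphere_unit_of/wn0.
have va i l : a k i ord0 l @[k --> U] --> v ord0 l.
  by apply: cvg_unit_of => // m; apply: cvg_normal_field => j; exact: tP.
(* Boundedness of the images gives limits of the levels. As [f] may be discontinuous, the limit for
   measure [p.2] can depend on the label [p.1] of the approximating points. *)
have lim_g (p : 'I_n * 'I_n) : exists l : R, dotv (a k p.1) (f p.2 (a k p.1)) @[k --> U] --> l.
  have [M hM] := hbdd p.2.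
  apply: (@ultra_bounded_cvg _ _ _ _ (M * n%:R)) => k.
  have M0 : 0 <= M by exact: le_trans (normr_ge0 _) (hM _ (sa k p.1) i0).
  apply: le_trans (dotv_le_norm1 _ (hM _ (sa k p.1))) _.
  rewrite ler_wpM2l // -[n in n%:R]card_ord -sum1_card natr_sum.
  apply: ler_sum => j _; rewrite -(@expr_le1 _ 2) // real_normK ?num_real //.
  rewrite -(sa k p.1) /dotv (bigD1 j) //= -expr2 lerDl sumr_ge0 // => m _.
  by rewrite -expr2 sqr_ge0.
have [gam gamP] := choice lim_g.
(* At points labelled [i] the level of index [i] is maximal, and this passes to the limit. *)
have gle i j : gam (i, j) <= gam (i, i).
  rewrite -subr_ge0; apply: (cvgr_to_ge (cvgB (gamP (i, i)) (gamP (i, j)))).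
  apply: nearW => k /=; rewrite subr_ge0; have [_ lX _] := XP k.
  by have := labP k (X k i) j; rewrite lX.
have gmu i j : mu j (hplus v (gam (i, j)) : set (borelRn R n)) = (alpha j)%:E.
  apply: hplus_closed_graph => // d d0.
  have nv : \forall k \near U, forall l, `|v ord0 l - a k i ord0 l| <= d.
    by apply: filter_forall => l; have /cvgrPdist_le := va i l; exact.
  have /cvgrPdist_le/(_ _ d0) ng := gamP (i, j).
  have [k [k1 k2]] := filter_ex (filterI nv ng).
  exists (a k i), (dotv (a k i) (f j (a k i))); split => [l||].
  - by rewrite distrC.
  - by rewrite distrC.
  - exact: hf.
have [lam lamP] := exists_common_level hn gle.
exists v, lam; split=> // j; have [i [i' /andP[h1 h2]]] := lamP j.
(* The measure decreases with the level, and [lam] lies between two levels at which measure [j] has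
   the value [alpha j]. *)
have mono r s : r <= s ->
    (mu j (hplus v s : set (borelRn R n)) <= mu j (hplus v r : set (borelRn R n)))%E.
  move=> rs; apply: le_measure; rewrite ?inE; try exact: measurable_hplus.
  by move=> x /=; exact: le_trans.
apply/eqP; rewrite eq_le -{1}(gmu i j) -(gmu i' j).
by rewrite !mono.
Qed.
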